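(* Let $\chi:\mathbb{R}\to\mathbb{R}$ be a kernel satisfying conditions $(\chi1)$–$(\chi5)$ (listed in the context), and let $f\in C_{+}(\mathbb{R})$ be fixed. If $$\|S_{w}^{\chi}(f)-f\|_{\infty}=o\left(\frac{1}{w}\right)\quad\text{as } w\to+\infty,$$ then $f$ is a constant function; i.e., the saturation order of the family $(S_{w}^{\chi})_{w>0}$ in $C_{+}(\mathbb{R})$ is $\frac{1}{w}$ (with trivial class the non-negative constant functions).
   Context: $C_{+}(\mathbb{R})$ is the set of all non-negative, bounded, uniformly continuous functions $f:\mathbb{R}\to\mathbb{R}$, and $\|\cdot\|_\infty$ is the sup-norm on $\mathbb{R}$. The symbol $\bigvee_{k\in J}A_k$ denotes $\sup\{A_k: k\in J\}$. Kernel conditions: $\chi:\mathbb{R}\to\mathbb{R}$ is bounded and measurable, and $(\chi1)$ for some $\beta>0$, $\sup_{y\in\mathbb{R}}|\chi(y)|\,|y|^{\beta}<+\infty$; $(\chi2)$ $\inf_{x\in[-1/2,1/2]}\chi(x)=:a_\chi>0$; $(\chi3)$ $\chi$ is continuous on $\mathbb{R}$, $\chi(x)\ge 0$ for every $x\in\mathbb{R}$, and $\lim_{|x|\to+\infty}\chi(x)=0$; $(\chi4)$ $\chi$ is even; $(\chi5)$ $\chi(x)$ is non-decreasing for $x<0$ and non-increasing for $x\ge 0$. For bounded $f:\mathbb{R}\to\mathbb{R}$ and real $w>0$, the max-product generalized sampling operator is $$S_{w}^{\chi}(f)(x)=\frac{\bigvee_{k\in\mathbb{Z}}f\left(\frac{k}{w}\right)\chi(wx-k)}{\bigvee_{k\in\mathbb{Z}}\chi(wx-k)},\quad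 x\in\mathbb{R}.$$ Saturation order: given a class $\mathcal{D}$ of functions with a norm $\|\cdot\|$, a subclass $\mathcal{E}\subset\mathcal{D}$ of trivial functions, and a positive non-increasing function $\varphi(w)$, $w>0$, one says $\varphi$ is the saturation order of $(L_w)_{w>0}$ in $\mathcal{D}$ if there exists $g\in\mathcal{D}\setminus\mathcal{E}$ with $\|L_w(g)-g\|=\mathcal{O}(\varphi(w))$ as $w\to+\infty$, and, whenever $f\in\mathcal{D}$ and $\|L_w(f)-f\|=o(\varphi(w))$ as $w\to+\infty$, then $f\in\mathcal{E}$. Here $\mathcal{D}=C_+(\mathbb{R})$ with the sup-norm, $\mathcal{E}$ is the set of non-negative constant functions, and $\varphi(w)=1/w$. *)

(* Defs.v *)
From HB Require Import structures.
From mathcomp Require Import all_boot all_order all_algebra.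
From mathcomp Require Import all_classical all_reals all_analysis.

Set Implicit Arguments.
Unset Strict Implicit.
Unset Printing Implicit Defensive.

Import Order.TTheory GRing.Theory Num.Theory.
Import numFieldNormedType.Exports.

Local Open Scope classical_set_scope.
Local Open Scope ring_scope.

(* Lets the Landau notations =o_ and =O_ apply to the filter +oo. *)
Canonical pinfty_filter_on (R : numFieldType) :=
  FilterType (pinfty_nbhs R) (@filter_filter R _ _).

(* [sup] is the real supremum, with the junk value 0 on sets without an upper
   bound.  For an admissible kernel and a bounded f, all the sets it is applied
   to below are nonempty and bounded, so it is the genuine supremum. *)

Definition sup_norm (R : realType) (f : R -> R) : R :=
  sup (range (fun x => `|f x|)).

Definition Cplus (R : realType) : set (R -> R) :=
  [set f : R -> R | [/\ forall x, 0 <= f x, bounded_fun f & unif_continuous f]].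

Definition nonneg_constants (R : realType) : set (R -> R) :=
  [set f | exists2 c : R, 0 <= c & f = cst c].

Arguments Cplus R _ : clear implicits.
Arguments nonneg_constants R _ : clear implicits.

(* Conditions (chi1)-(chi5), together with boundedness and measurability.  The
   limit for |x| -> +oo in (chi3) is given as the two limits at +oo and -oo. *)
Record admissible_kernel (R : realType) (chi : R -> R) : Prop := {
  chi_bounded : bounded_fun chi;
  chi_measurable : measurable_fun [set: R] chi;
  chi1 : exists2 beta : R, 0 < beta &
    has_ubound (range (fun y : R => `|chi y| * `|y| `^ beta));
  chi2 : 0 < inf (chi @` `[- 2^-1, 2^-1]);
  chi3_continuous : continuous chi;
  chi3_ge0 : forall x, 0 <= chi x;
  chi3_cvgpinfty : chi x @[x --> +oo] --> 0;
  chi3_cvgninfty : chi x @[x --> -oo] --> 0;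
  chi4 : forall x, chi (- x) = chi x;
  chi5_nondecreasing : forall x y : R, x <= y -> y < 0 -> chi x <= chi y;
  chi5_nonincreasing : forall x y : R, 0 <= x -> x <= y -> chi y <= chi x
}.

Definition maxprod_sampling (R : realType) (chi : R -> R) (w : R)
    (f : R -> R) : R -> R :=
  fun x => sup (range (fun k : int => f (k%:~R / w) * chi (w * x - k%:~R)))
         / sup (range (fun k : int => chi (w * x - k%:~R))).

(* D is the ambient class, N its norm, E the class of trivial elements. *)
Definition saturation_order (R : realType) (V : zmodType) (D : set V)
    (N : V -> R) (E : set V) (L : R -> V -> V) (phi : R -> R) : Prop :=
  [/\ E `<=` D,
      forall w : R, 0 < w -> 0 < phi w,
      forall v w : R, 0 < v -> v <= w -> phi w <= phi v,
      exists2 g, (D `\` E) g & (fun w => N (L w g - g)) =O_+oo phi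
    & forall f, D f -> (fun w => N (L w f - f)) =o_+oo phi -> E f].

(* Main.v *)
Require Import Defs.
From mathcomp Require Import all_boot all_order all_algebra.
From mathcomp Require Import all_classical all_reals all_analysis.
From mathcomp Require Import ring lra zify.

(** An even unimodal kernel takes its largest sampled value at the sample
    nearest to [w x], so [S_w f (x) >= f (k / w)] whenever [|w x - k| <= 1/2]
    ([maxprod_sampling_near_ge]).  At the midpoint of two consecutive nodes both
    of them are nearest.  If the error is at most [e / w], the value of [f] at
    that midpoint is therefore at least its value at either node, up to [e / w]
    ([small_o_midpoint_rise]).

    Such an inequality, valid on all fine grids, makes [f] constant.  Starting
    from a node and repeatedly halving the distance to the next one, the values
    of [f] drop by at most the geometric series [(e / w) (1 + 1/2 + 1/4 + ...)],
    and continuity at the limit compares the two neighbouring nodes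
    ([midpoint_rise_adjacent]); by symmetry their values differ by at most
    [2 e / w].  Summing over the nodes of a grid joining [0] to [x] gives
    [|f x - f 0| <= 2 e |x|] for every [e > 0] ([midpoint_rise_constant]).

    The rate [1 / w] is attained by a Lipschitz function with values in
    [[1, 2]] ([ramp_error]): for a sample far from [w x] the kernel is at most
    half of the denominator, hence such a sample cannot push the quotient above
    1, and the other samples are at distance [O(1 / w)] from [x]. *)

Import Order.TTheory GRing.Theory Num.Theory.
Import numFieldNormedType.Exports.

Set Implicit Arguments.
Unset Strict Implicit.
Unset Printing Implicit Defensive.

Local Open Scope classical_set_scope.
Local Open Scope ring_scope.

(** * Functions dominated by their midpoint values *)

(** The increment [h] may be negative, so that reflecting the grid ([h] to [-h],
    [j] to [-(j + 1)]) also bounds [f ((j + 1) h)] by the midpoint value. *)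
Definition midpoint_rise (R : realType) (f : R -> R) (e d : R) :=
  forall (h : R) (j : int), 0 < `|h| -> `|h| <= d ->
    f (j%:~R * h) <= f ((j%:~R + 2^-1) * h) + e * `|h|.

(** Walking from [j h] towards [(j + 1) h] by halving the remaining distance:
    the point [(j + 1 - 2^-n) h] is a node of the grid of step [h / 2^n], and
    its successor on the walk is the next midpoint of that same grid.  The
    losses [e |h| / 2^n] form a geometric series of sum at most [2 e |h|]. *)
Lemma midpoint_rise_pow (R : realType) (f : R -> R) (e d h : R) (j : int)
    (n : nat) :
  0 <= e -> midpoint_rise f e d -> 0 < `|h| -> `|h| <= d ->
  f (j%:~R * h) <= f ((j%:~R + 1 - 2 ^- n) * h) + 2 * (1 - 2 ^- n) * (e * `|h|).
Proof.
move=> e0 rise h0 hd; elim: n => [|n IH].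
  by rewrite expr0 invr1 addrK subrr mulr0 !mul0r addr0.
apply: (le_trans IH).
have p0 : 0 < 2 ^- n :> R by rewrite invr_gt0 exprn_gt0.
have p1 : 2 ^- n <= 1 :> R by rewrite invf_le1 ?exprn_gt0// exprn_ege1// ler1n.
have ph : `|h * 2 ^- n| = `|h| * 2 ^- n by rewrite normrM (gtr0_norm p0).
have := rise (h * 2 ^- n) ((j + 1) * 2 ^ n - 1).
rewrite ph => /(_ (mulr_gt0 h0 p0) (le_trans (ler_piMr (ltW h0) p1) hd)).
have -> : ((j + 1) * 2 ^ n - 1)%:~R = (j%:~R + 1) * 2 ^+ n - 1 :> R.
  by rewrite rmorphB rmorphM/= rmorphD/= -exprnP rmorphXn/=.
have -> : ((j%:~R + 1) * 2 ^+ n - 1) * (h * 2 ^- n) = (j%:~R + 1 - 2 ^- n) * h.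
  by field; rewrite expf_neq0.
have -> : ((j%:~R + 1) * 2 ^+ n - 1 + 2^-1) * (h * 2 ^- n)
   = (j%:~R + 1 - 2 ^- n.+1) * h.
  by rewrite exprS; field; rewrite expf_neq0.
have -> : 2 ^- n.+1 = 2 ^- n / 2 :> R by rewrite exprS invfM mulrC.
lra.
Qed.

(** The walk of [midpoint_rise_pow] converges to [(j + 1) h], so continuity
    passes its bound to the limit. *)
Lemma midpoint_rise_adjacent (R : realType) (f : R -> R) (e d h : R) (j : int) :
  continuous f -> 0 <= e -> midpoint_rise f e d -> 0 < `|h| -> `|h| <= d ->
  f (j%:~R * h) <= f ((j%:~R + 1) * h) + 2 * (e * `|h|).
Proof.
move=> cf e0 rise h0 hd; apply/ler_addgt0Pr => r r0.
have /cvgrPdist_lt/(_ r r0)/nbhs_ballP[s /= s0 near_s] := cf ((j%:~R + 1) * h).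
have [n hn] : exists n : nat, `|h| < s * 2 ^+ n.
  exists (Num.bound (`|h| / s)).
  rewrite -ltr_pdivrMl// mulrC.
  have q0 : 0 <= `|h| / s by rewrite divr_ge0// ltW.
  apply: (lt_le_trans (archi_boundP q0)).
  by rewrite -natrX ler_nat ltnW// ltn_expl.
have := midpoint_rise_pow j n e0 rise h0 hd.
have p0 : 0 < 2 ^- n :> R by rewrite invr_gt0 exprn_gt0.
have : `|f ((j%:~R + 1) * h) - f ((j%:~R + 1 - 2 ^- n) * h)| < r.
  apply: near_s; rewrite /ball/=.
  have -> : (j%:~R + 1) * h - (j%:~R + 1 - 2 ^- n) * h = h * 2 ^- n by ring.
  by rewrite normrM (gtr0_norm p0) ltr_pdivrMr// exprn_gt0.
rewrite ltr_norml => /andP[? _] H.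
have : 0 <= 2 ^- n * (e * `|h|) by rewrite mulr_ge0 ?mulr_ge0// ltW.
nra.
Qed.

(** Neighbouring nodes have values within [2 e |h|] of each other, in both
    directions by reflection.  Along [0, h, ..., n h = x] the differences add up
    to at most [2 e |x|], whatever [n] is, and [e] is arbitrary. *)
Lemma midpoint_rise_constant (R : realType) (f : R -> R) :
  continuous f ->
  (forall e, 0 < e -> exists2 d, 0 < d & midpoint_rise f e d) ->
  f = cst (f 0).
Proof.
move=> cf rise; apply/funext => x /=.
have [->//|x0] := eqVneq x 0.
have nx0 : 0 < `|x| by rewrite normr_gt0.
apply/eqP; rewrite -subr_eq0 -normr_le0; apply/ler_addgt0Pr => r r0.
rewrite add0r.
(* Chosen so that the telescoped bound [2 e |x|] is exactly [r]. *)
pose e := r / (2 * `|x|).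
have e0 : 0 < e by rewrite divr_gt0// mulr_gt0.
have [d d0 rised] := rise e e0.
pose n := (Num.bound (`|x| / d)).+1.
have n0 : 0 < n%:R :> R by rewrite ltr0n.
pose h := x / n%:R.
have nh : `|h| = `|x| / n%:R by rewrite normrM normfV (gtr0_norm n0).
have h0 : 0 < `|h| by rewrite nh divr_gt0.
have hd : `|h| <= d.
  rewrite nh ler_pdivrMr// mulrC -ler_pdivrMr//.
  have q0 : 0 <= `|x| / d by rewrite divr_ge0// ltW.
  by apply/ltW/(lt_le_trans (archi_boundP q0)); rewrite ler_nat.
have step (i : nat) :
    `|f (i.+1%:R * h) - f (i%:R * h)| <= 2 * (e * `|h|).
  have up := midpoint_rise_adjacent i cf (ltW e0) rised h0 hd.
  have h0' : 0 < `|- h| by rewrite normrN.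
  have hd' : `|- h| <= d by rewrite normrN.
  (* The reflected grid: its edge from node [-(i + 1)] goes from [(i + 1) h] to
     [i h]. *)
  have := midpoint_rise_adjacent (- i.+1%:Z) cf (ltW e0) rised h0' hd'.
  rewrite normrN.
  have -> : (- i.+1%:Z)%:~R * - h = i.+1%:R * h by rewrite rmorphN/= mulrNN.
  have -> : ((- i.+1%:Z)%:~R + 1) * - h = i%:R * h.
    by rewrite rmorphN/= [i.+1%:~R](_ : _ = i%:R + 1) ?natr1//; ring.
  move: up; rewrite [_%:~R + 1]natr1 => up down.
  by rewrite ler_norml; apply/andP; split; lra.
have tele (i : nat) : `|f (i%:R * h) - f 0| <= i%:R * (2 * (e * `|h|)).
  elim: i => [|i IH]; first by rewrite !mul0r subrr normr0.
  rewrite -[in leRHS]natr1 mulrDl mul1r.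
  apply: le_trans (lerD IH (step i)).
  by apply: le_trans (ler_normD _ _); rewrite [in leRHS]addrC subrKA.
have := tele n.
have -> : n%:R * h = x by rewrite mulrC divfK// gt_eqF.
have -> // : n%:R * (2 * (e * `|h|)) = r.
by rewrite nh /e; field; rewrite !gt_eqF.
Qed.

(** * The kernel and its largest sample *)

Lemma kernel_le (R : realType) (chi : R -> R) (x y : R) :
  admissible_kernel chi -> `|x| <= `|y| -> chi y <= chi x.
Proof.
move=> hchi xy.
have chi_norm z : chi `|z| = chi z.
  by case: (ger0P z) => // _; exact: chi4.
by rewrite -chi_norm -(chi_norm x); apply: chi5_nonincreasing.
Qed.

(** [chi (1/2)] is the least value of the kernel on [[-1/2, 1/2]]; it serves
    below as the uniform lower bound of the denominator. *)
Lemma kernel_half_gt0 (R : realType) (chi : R -> R) :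
  admissible_kernel chi -> 0 < chi 2^-1.
Proof.
move=> hchi; apply: lt_le_trans (chi2 hchi) _.
apply: ge_inf; first by exists 0 => _ [y _ <-]; exact: chi3_ge0.
by exists 2^-1 => //=; rewrite in_itv/=; apply/andP; split; lra.
Qed.

Lemma near_int (R : realType) (t : R) : exists k : int, `|t - k%:~R| <= 2^-1.
Proof.
exists (Num.floor (t + 2^-1)); have := floor_le (t + 2^-1).
have := floorD1_gt (t + 2^-1); rewrite intrD => lo hi.
by rewrite ler_norml; apply/andP; split; lra.
Qed.

Definition kernel_max (R : realType) (chi : R -> R) (t : R) : R :=
  sup (range (fun k : int => chi (t - k%:~R))).

Lemma kernel_max_ge (R : realType) (chi : R -> R) (t : R) (k : int) :
  admissible_kernel chi -> chi (t - k%:~R) <= kernel_max chi t.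
Proof.
move=> hchi; apply: ub_le_sup; last by exists k.
by exists (chi 0) => _ [l _ <-]; apply: kernel_le => //; rewrite normr0.
Qed.

Lemma kernel_max_ge_half (R : realType) (chi : R -> R) (t : R) :
  admissible_kernel chi -> chi 2^-1 <= kernel_max chi t.
Proof.
move=> hchi; have [k kt] := near_int t.
apply: le_trans (kernel_max_ge _ k hchi).
by apply: kernel_le => //; rewrite [leRHS]ger0_norm.
Qed.

(** By [kernel_le] the kernel decreases with the distance to the sample, and [k]
    is a nearest integer to [t].  The bound 1/2 is not strict because the
    saturation argument lives on ties, where two samples are nearest. *)
Lemma kernel_max_near (R : realType) (chi : R -> R) (t : R) (k : int) :
  admissible_kernel chi -> `|t - k%:~R| <= 2^-1 ->
  kernel_max chi t = chi (t - k%:~R).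
Proof.
move=> hchi tk; apply/eqP; rewrite eq_le kernel_max_ge// andbT.
apply: ge_sup; first by exists (chi (t - 0%:~R)), 0.
move=> _ [l _ <-]; apply: kernel_le => //.
have -> : t - l%:~R = t - k%:~R + (k - l)%:~R by rewrite intrD rmorphN/=; lra.
move: (t - k%:~R) tk => s /[dup] s2; rewrite ler_norml => /andP[slo shi].
have [m0|m0|->] := ltgtP (k - l) 0; last by rewrite addr0.
- have : (k - l)%:~R <= (-1)%:~R :> R by rewrite ler_int; lia.
  rewrite rmorphN/= => ?; apply: (le_trans s2).
  by rewrite ler_normr; apply/orP; right; lra.
- have : 1%:~R <= (k - l)%:~R :> R by rewrite ler_int; lia.
  by move=> ?; apply: (le_trans s2); rewrite ler_normr; apply/orP; left; lra.
Qed.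

(** * Bounds for the operator and the sup-norm *)

(** The term of index [k] in the numerator carries the weight
    [chi (w x - k)], which by [kernel_max_near] equals the denominator. *)
Lemma maxprod_sampling_near_ge (R : realType) (chi f : R -> R) (M w x : R)
    (k : int) :
  admissible_kernel chi -> (forall y, 0 <= f y <= M) ->
  `|w * x - k%:~R| <= 2^-1 -> f (k%:~R / w) <= maxprod_sampling chi w f x.
Proof.
move=> hchi fM xk; rewrite /maxprod_sampling -/(kernel_max chi (w * x)).
rewrite ler_pdivlMr; last first.
  by rewrite (lt_le_trans (kernel_half_gt0 hchi))// kernel_max_ge_half.
rewrite (kernel_max_near (k := k))//; apply: ub_le_sup; last by exists k.
exists (M * chi 0) => _ [l _ <-].
have /andP[f0 fle] := fM (l%:~R / w).
apply: ler_pM => //; first exact: chi3_ge0.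
by apply: kernel_le => //; rewrite normr0.
Qed.

Lemma maxprod_sampling_le (R : realType) (chi f : R -> R) (w x B : R) :
  admissible_kernel chi ->
  (forall k : int, f (k%:~R / w) * chi (w * x - k%:~R) <=
     B * kernel_max chi (w * x)) ->
  maxprod_sampling chi w f x <= B.
Proof.
move=> hchi H; rewrite /maxprod_sampling -/(kernel_max chi (w * x)).
rewrite ler_pdivrMr; last by rewrite (lt_le_trans (kernel_half_gt0 hchi))//
  kernel_max_ge_half.
apply: ge_sup => [|_ [k _ <-]//].
by exists (f (0%:~R / w) * chi (w * x - 0%:~R)), 0.
Qed.

Lemma sup_norm_ge (R : realType) (g : R -> R) (B x : R) :
  (forall y, `|g y| <= B) -> `|g x| <= sup_norm g.
Proof.
by move=> gB; apply: ub_le_sup; [exists B => _ [y _ <-]|exists x].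
Qed.

Lemma sup_norm_le (R : realType) (g : R -> R) (B : R) :
  (forall y, `|g y| <= B) -> 0 <= sup_norm g <= B.
Proof.
move=> gB; rewrite (le_trans (normr_ge0 (g 0)) (sup_norm_ge _ gB))/=.
by apply: ge_sup => [|_ [y _ <-]//]; exists `|g 0|, 0.
Qed.

Lemma maxprod_sampling_range (R : realType) (chi f : R -> R) (M w x : R) :
  admissible_kernel chi -> (forall y, 0 <= f y <= M) ->
  0 <= maxprod_sampling chi w f x <= M.
Proof.
move=> hchi fM; have [k xk] := near_int (w * x).
have /andP[f0 _] := fM (k%:~R / w).
rewrite (le_trans f0 (maxprod_sampling_near_ge hchi fM xk))/=.
apply: maxprod_sampling_le => // l; have /andP[fl0 flM] := fM (l%:~R / w).
by apply: ler_pM => //; [exact: chi3_ge0|exact: kernel_max_ge].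
Qed.

(** * From the error rate o(1/w) to midpoint inequalities *)

Lemma Cplus_range (R : realType) (f : R -> R) :
  Cplus R f -> exists M, forall y, 0 <= f y <= M.
Proof.
move=> [f0 [M [_ fM]] _]; exists (M + 1) => y; rewrite f0/=.
by rewrite -[f y]ger0_norm//; apply: fM => //; rewrite ltrDl.
Qed.

Lemma Cplus_continuous (R : realType) (f : R -> R) : Cplus R f -> continuous f.
Proof.
move=> [_ _ /unif_continuousP uf] x; apply/cvgrPdist_lt => e e0.
have [d d0 fd] := uf e e0.
by apply/nbhs_ballP; exists d => //= y xy; exact: (fd (x, y)).
Qed.

(** At the midpoint of two consecutive samples both are nearest samples, so
    the operator dominates [f] at each of them, while it exceeds [f] at the
    midpoint itself by at most [e / w]. *)
Lemma small_o_midpoint_rise (R : realType) (chi f : R -> R) (e : R) :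
  admissible_kernel chi -> Cplus R f ->
  (fun w : R => sup_norm (maxprod_sampling chi w f - f)) =o_+oo
    (fun w : R => w^-1) ->
  0 < e -> exists2 d, 0 < d & midpoint_rise f e d.
Proof.
move=> hchi fC /eqoP small e0; have [M fM] := Cplus_range fC.
have [W [_ HW]] := small e e0.
have W0 : 0 < `|W| + 1 by rewrite ltr_pwDr.
exists ((`|W| + 1)^-1); first by rewrite invr_gt0.
move=> h j h0 hd; pose w := `|h|^-1; pose x := (j%:~R + 2^-1) * h.
have w0 : 0 < w by rewrite invr_gt0.
have Ww : W < w.
  rewrite (le_lt_trans (ler_norm W))//.
  rewrite (@lt_le_trans _ _ (`|W| + 1)) ?ltrDl// /w -[leLHS]invrK.
  by rewrite lef_pV2// posrE invr_gt0.
have error y : `|(maxprod_sampling chi w f - f) y| <= M.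
  have /andP[? ?] := fM y.
  have /andP[? ?] := maxprod_sampling_range w y hchi fM.
  by rewrite !fctE ler_norml; apply/andP; split; lra.
have /= := HW w Ww.
have /andP[s0 _] := sup_norm_le error.
rewrite (ger0_norm s0) (gtr0_norm (_ : 0 < w^-1)) ?invr_gt0// /w invrK -/w.
move=> /(le_trans (sup_norm_ge x error)); rewrite ler_norml => /andP[_].
rewrite !fctE lerBlDl => {}HW.
apply: le_trans HW.
(* For [h < 0] the sampling grid of step [1 / w = - h] carries the node [j h]
   at the index [- j]. *)
have [k kh xk] : exists2 k : int, k%:~R / w = j%:~R * h &
    `|w * x - k%:~R| <= 2^-1.
  rewrite /w invrK /x.
  have hn0 : `|h| != 0 by rewrite gt_eqF.
  case: (ger0P h) hn0 => [hp|hn] hn0; [exists j => //|exists (- j)].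
  - rewrite (_ : _ - _ = 2^-1) ?ger0_norm//; by field.
  - by rewrite rmorphN/= mulrNN.
  - rewrite (_ : _ - _ = - 2^-1) ?normrN ?ger0_norm//.
    by rewrite rmorphN/=; field; move: hn0; rewrite oppr_eq0.
rewrite -kh; exact: maxprod_sampling_near_ge hchi fM xk.
Qed.

(** * A non-constant function approximated at the rate 1/w *)

(** The witness of the rate [1 / w].  Its values in [[1, 2]] are bounded away
    from 0, which makes a distant sample harmless as soon as its weight is less
    than half of the denominator. *)
Definition ramp (R : realType) (x : R) : R := 1 + Num.min `|x| 1.

Lemma ramp_range (R : realType) (x : R) : 1 <= ramp x <= 2.
Proof.
rewrite /ramp lerDl le_min normr_ge0 ler01/=.
by have : Num.min `|x| 1 <= 1 by [rewrite ge_min lexx orbT]; lra.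
Qed.

Lemma ramp_lipschitz (R : realType) (x y : R) : `|ramp x - ramp y| <= `|x - y|.
Proof.
have := ler_dist_dist x y; rewrite /ramp ler_norml => /andP[? ?].
rewrite ler_norml !minEle.
by case: (leP `|x| 1); case: (leP `|y| 1) => ? ?; apply/andP; split; lra.
Qed.

Lemma ramp_Cplus (R : realType) : Cplus R (@ramp R).
Proof.
split.
- by move=> x; have /andP[? _] := ramp_range x; lra.
- exists 2; split; first exact: num_real.
  move=> M M2 x _ /=; have /andP[? ?] := ramp_range x.
  by rewrite ger0_norm//; lra.
- apply/unif_continuousP => e e0; exists e => // -[x y].
  rewrite /ball/=; exact: le_lt_trans (ramp_lipschitz x y).
Qed.

Lemma ramp_nonconstant (R : realType) : ~ nonneg_constants R (@ramp R).
Proof.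
move=> [c _ rc]; have := congr1 (fun g => g 0) rc.
have := congr1 (fun g => g 1) rc.
rewrite /ramp/= normr0 normr1 minxx min_l// => <-; lra.
Qed.

Lemma kernel_half_tail (R : realType) (chi : R -> R) :
  admissible_kernel chi ->
  exists2 Y, 0 < Y & forall y, Y <= `|y| -> chi y <= chi 2^-1 / 2.
Proof.
move=> hchi; have a0 := kernel_half_gt0 hchi.
have /cvgrPdist_le/(_ _ (divr_gt0 a0 (ltr0Sn _ 1)))[Y [_ HY]] :=
  chi3_cvgpinfty hchi.
exists (`|Y| + 1) => [|y Yy]; first by rewrite ltr_pwDr.
apply: le_trans (_ : chi (`|Y| + 1) <= _).
  by apply: kernel_le => //; rewrite [leLHS]ger0_norm ?addr_ge0.
have /= := HY (`|Y| + 1); rewrite sub0r normrN => HY1.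
apply: le_trans (ler_norm _) (HY1 _).
by rewrite (le_lt_trans (ler_norm Y))// ltrDl.
Qed.

(** Samples at distance less than [Y] from [w x] are controlled by the Lipschitz
    bound.  A more distant sample weighs at most half of the denominator and
    has value at most 2, so it contributes at most [1 <= ramp x].  The
    lower bound comes from the nearest sample. *)
Lemma ramp_error (R : realType) (chi : R -> R) :
  admissible_kernel chi -> exists C, forall w x : R, 0 < w ->
    `|maxprod_sampling chi w (@ramp R) x - ramp x| <= C / w.
Proof.
move=> hchi; have [Y Y0 tail] := kernel_half_tail hchi.
exists (Y + 2^-1) => w x w0.
have dist k : `|ramp (k%:~R / w) - ramp x| <= `|w * x - k%:~R| / w.
  apply: (le_trans (ramp_lipschitz _ _)).
  rewrite (_ : k%:~R / w - x = - (w * x - k%:~R) / w).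
    by rewrite normrM normrN normfV (gtr0_norm w0).
  by field; rewrite gt_eqF.
have w0' : 0 < w^-1 by rewrite invr_gt0.
have range (y : R) : 0 <= ramp y <= 2.
  by have /andP[? ?] := ramp_range y; apply/andP; split; lra.
rewrite ler_norml; apply/andP; split.
  have [k xk] := near_int (w * x).
  have := maxprod_sampling_near_ge hchi range xk.
  have := dist k; rewrite ler_norml => /andP[+ _].
  have := ler_wpM2r (ltW w0') xk.
  nra.
rewrite lerBlDl; apply: maxprod_sampling_le => // k.
have kmax0 := lt_le_trans (kernel_half_gt0 hchi)
  (kernel_max_ge_half (w * x) hchi).
have /andP[g1 _] := ramp_range x.
have /andP[gk0 gk2] := range (k%:~R / w).
have chi0 := chi3_ge0 hchi (w * x - k%:~R).
have Cw0 : 0 <= (Y + 2^-1) / w by rewrite divr_ge0 ?addr_ge0// ltW.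
have [far|near_k] := leP Y `|w * x - k%:~R|; last first.
  apply: ler_pM => //; last exact: kernel_max_ge.
  have := dist k; rewrite ler_norml => /andP[_].
  have := ler_wpM2r (ltW w0') (ltW near_k); nra.
apply: (@le_trans _ _ (1 * kernel_max chi (w * x))).
  apply: le_trans (ler_pM gk0 chi0 gk2 (tail _ far)) _.
  by have := kernel_max_ge_half (w * x) hchi; lra.
by apply: ler_wpM2r; [exact: ltW|lra].
Qed.

(** * The saturation order 1/w *)

Theorem theorem3p1 (R : realType) (chi : R -> R) (hchi : admissible_kernel chi) :
  (forall f : R -> R, Cplus R f ->
     (fun w : R => sup_norm (maxprod_sampling chi w f - f)) =o_+oo
       (fun w : R => w^-1) ->
     exists c : R, f = cst c)
  /\ saturation_order (Cplus R) (@sup_norm R) (nonneg_constants R)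
       (maxprod_sampling chi) (fun w : R => w^-1).
Proof.
have const f : Cplus R f ->
    (fun w : R => sup_norm (maxprod_sampling chi w f - f)) =o_+oo
      (fun w : R => w^-1) -> f = cst (f 0).
  move=> fC small; apply: midpoint_rise_constant.
    exact: Cplus_continuous.
  by move=> e; exact: small_o_midpoint_rise hchi fC small.
split; first by move=> f fC small; exists (f 0); exact: const.
split.
- move=> _ [c c0 ->]; split => //; first exact: bounded_cst.
  by apply/unif_continuousP => e e0; exists 1 => // x _; exact: ballxx.
- by move=> w; rewrite invr_gt0.
- by move=> v w v0 vw; rewrite lef_pV2// posrE// (lt_le_trans v0).
- exists (@ramp R); first by split; [exact: ramp_Cplus|exact: ramp_nonconstant].
  apply/eqOP; have [C err] := ramp_error hchi.
  exists C; split; first exact: num_real.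
  move=> D CD; exists 0; split => // w w0 /=.
  have {}err y : `|(maxprod_sampling chi w (@ramp R) - @ramp R) y| <= C / w.
    exact: err.
  have /andP[s0 sC] := sup_norm_le err.
  rewrite (ger0_norm s0) (gtr0_norm (_ : 0 < w^-1)) ?invr_gt0//.
  by rewrite (le_trans sC)// ler_wpM2r// ?ltW// invr_gt0.
- by move=> f fC small; exists (f 0); [case: fC|exact: const].
Qed.
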